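(* Let $p$ be a prime with $p>5$. Then the $n$-th Fibonacci polynomial $f_n(x)$, considered as a polynomial over $\mathbb{Z}_p=\mathbb{Z}/p\mathbb{Z}$, is self-reciprocal if and only if $n\in\{3,5\}$.
   Context: The Fibonacci polynomials are defined by $f_0(x)=0$, $f_1(x)=1$, and $f_n(x)=xf_{n-1}(x)+f_{n-2}(x)$ for $n\ge 2$; here their coefficients are reduced modulo $p$. The reciprocal of a polynomial $f(x)$ of degree $d$ is $f^*(x)=x^d f(1/x)$. A polynomial $f$ is called self-reciprocal if $f^*=f$, i.e. if $f(x)=a_0+a_1x+\cdots+a_dx^d$ with $a_d\neq 0$, then $a_i=a_{d-i}$ for all $0\le i\le d$.
   Formalization: The case n = 1 is excluded, because the constant polynomial f_1(x) = 1 is self-reciprocal by the definition although 1 is not in {3,5}. *)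

(* Defs.v *)
From mathcomp Require Import all_boot all_order all_algebra.

Set Implicit Arguments.
Unset Strict Implicit.
Unset Printing Implicit Defensive.

Import GRing.Theory.
Local Open Scope ring_scope.

Fixpoint fib_poly (n : nat) : {poly int} :=
  match n with
  | 0%N => 0
  | 1%N => 1
  | (m.+1 as k).+1 => 'X * fib_poly k + fib_poly m
  end.

Definition fib_poly_mod (p n : nat) : {poly 'F_p} :=
  map_poly (intr : int -> 'F_p) (fib_poly n).

(* x^d f(1/x), where d = (size f).-1 is the degree of f *)
Definition reciprocal (R : nzRingType) (f : {poly R}) : {poly R} :=
  \sum_(i < size f) f`_i *: 'X^((size f).-1 - i).

(* The zero polynomial has no nonzero leading coefficient a_d, hence no
   reciprocal; it is excluded. Nonzero constants are self-reciprocal. *)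
Definition self_reciprocal (R : nzRingType) (f : {poly R}) : Prop :=
  f != 0 /\ reciprocal f = f.

(* Main.v *)
(* The coefficient of x^(2k) in f_(2m+1) is 'C(m + k, 2k), so self-reciprocity
   of f_(2m+1) means 'C(m + k, 2k) = 'C(2m - k, k) mod p for all k <= m. The
   case k = 1 reads (m - 1)(m - 2) = 0, so m = 1 + pa or m = 2 + pa. If a > 0,
   the cases k = (p + 1)/2 and k = (p + 3)/2, evaluated by Lucas' congruences,
   give two incompatible conditions on a: 3a = 3 and 15a = 0 if m = 1 + pa;
   8a = 7 and 7a = 8 if m = 2 + pa. *)

Require Import Defs.
From mathcomp Require Import all_boot all_order all_algebra.
From mathcomp Require Import zify ring.

Set Implicit Arguments.
Unset Strict Implicit.
Unset Printing Implicit Defensive.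

Import GRing.Theory.
Local Open Scope ring_scope.

(** * Self-reciprocity read on coefficients *)

Lemma reciprocal_poly (R : nzRingType) (f : {poly R}) :
  reciprocal f = \poly_(i < size f) f`_((size f).-1 - i).
Proof.
rewrite /reciprocal poly_def (reindex_inj rev_ord_inj) /=.
apply: eq_bigr => i _; have lti := ltn_ord i.
rewrite -[in LHS]subn1 -add1n subnDA subKn subn1 //.
by rewrite -ltnS (ltn_predK lti).
Qed.

Lemma self_reciprocalP (R : nzRingType) (f : {poly R}) :
  self_reciprocal f <->
  f != 0 /\ forall i, (i < size f)%N -> f`_((size f).-1 - i) = f`_i.
Proof.
split=> -[f0 Hf]; split=> //.
  by move=> i lti; rewrite -[RHS](congr1 (fun g : {poly R} => g`_i) Hf)
    reciprocal_poly coef_poly lti.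
apply/polyP=> i; rewrite reciprocal_poly coef_poly.
by case: ltnP => [/Hf|lei] //; rewrite nth_default.
Qed.

(** * Coefficients of the Fibonacci polynomials mod p *)

Section FibonacciPolynomialsModP.

Variable p : nat.
Local Notation F := (fib_poly_mod p).

Lemma fib_poly_mod0 : F 0 = 0.
Proof. exact: rmorph0. Qed.

Lemma fib_poly_mod1 : F 1 = 1.
Proof. exact: rmorph1. Qed.

Lemma fib_poly_modSS n : F n.+2 = 'X * F n.+1 + F n.
Proof. by rewrite /fib_poly_mod /= rmorphD rmorphM /= map_polyX. Qed.

Lemma size_fib_poly_mod n : size (F n.+1) = n.+1.
Proof.
(* The bound on [F n] is carried along so that ['X * F n.+1] dominates in the recurrence; it is only
   an inequality because [F 0] is zero. *)
suff [] : size (F n.+1) = n.+1 /\ (size (F n) <= n)%N by [].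
elim: n => [|n [IH1 IH2]].
  by rewrite fib_poly_mod0 fib_poly_mod1 size_poly1 size_poly0.
have sX : size ('X * F n.+1) = n.+2.
  by rewrite mulrC size_mulX ?IH1 // -size_poly_gt0 IH1.
by rewrite fib_poly_modSS IH1 size_polyDl sX // ltnS (leq_trans IH2) // leqW.
Qed.

(** Multiplication by ['X] exchanges the parities, so the four claims are proved by one induction;
    the recurrence then becomes Pascal's rule. *)
Lemma coef_fib_poly_mod m k :
  [/\ (F m.*2.+1)`_k.*2 = ('C(m + k, k.*2))%:R,
      (F m.*2.+1)`_k.*2.+1 = 0,
      (F m.*2.+2)`_k.*2 = 0 &
      (F m.*2.+2)`_k.*2.+1 = ('C((m + k).+1, k.*2.+1))%:R].
Proof.
elim: m k => [|m IH] k.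
  rewrite fib_poly_modSS fib_poly_mod0 fib_poly_mod1 mulr1 addr0.
  rewrite !coef1 !coefX add0n.
  case: k => [|k]; first by rewrite bin0 bin1.
  by rewrite doubleS !eqSS !bin_small //; lia.
have odd_odd j : (F m.+1.*2.+1)`_j.*2.+1 = 0.
  rewrite doubleS fib_poly_modSS coefD coefXM /=.
  by have [_ -> -> _] := IH j; rewrite addr0.
have odd_even j : (F m.+1.*2.+1)`_j.*2 = ('C(m.+1 + j, j.*2))%:R.
  rewrite doubleS fib_poly_modSS coefD coefXM.
  case: j => [|j]; first by have [-> _ _ _] := IH 0%N; rewrite !bin0 add0r.
  have [-> _ _ _] := IH j.+1; have [_ _ _ ->] := IH j.
  by rewrite doubleS /= -natrD addSn binS addnS addnC.
split=> //; rewrite fib_poly_modSS coefD coefXM doubleS.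
  case: k => [|k]; first by have [_ _ -> _] := IH 0%N; rewrite addr0.
  by have [_ _ -> _] := IH k.+1; rewrite -doubleS odd_odd addr0.
have [_ _ _ ->] := IH k.
by rewrite -doubleS /= odd_even -natrD addSn [in RHS]binS addnC.
Qed.

Lemma coef0_fib_poly_mod_even m : (F m.*2)`_0 = 0.
Proof.
case: m => [|m]; first by rewrite fib_poly_mod0 coef0.
by have [_ _ -> _] := coef_fib_poly_mod m 0.
Qed.

Lemma self_reciprocal_fib_poly_mod_odd m :
  self_reciprocal (F m.*2.+1) <->
  forall k, (k <= m)%N ->
    ('C(m + k, k.*2))%:R = ('C(m.*2 - k, k))%:R :> 'F_p.
Proof.
have binE k : (k <= m)%N -> 'C(m + (m - k), (m - k).*2) = 'C(m.*2 - k, k).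
  move=> lekm; rewrite -[RHS]bin_sub; last by lia.
  by congr 'C(_, _); lia.
have coef_rev k : (k <= m)%N ->
    (F m.*2.+1)`_(m.*2 - k.*2) = ('C(m.*2 - k, k))%:R.
  move=> lekm; rewrite -doubleB.
  by have [-> _ _ _] := coef_fib_poly_mod m (m - k); rewrite binE.
split=> [/self_reciprocalP[_] | H].
  rewrite size_fib_poly_mod /= => H k lekm.
  have [<- _ _ _] := coef_fib_poly_mod m k.
  by rewrite -H ?coef_rev //; lia.
apply/self_reciprocalP; split; first by rewrite -size_poly_gt0 size_fib_poly_mod.
rewrite size_fib_poly_mod /= => i lti.
rewrite -(odd_double_half i); set k := i./2.
case: (odd i) (odd_double_half i) => /= Ei; rewrite ?add1n ?add0n.
  (* The degree [m.*2] is even, so reversal preserves parity and matches vanishing odd coefficients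
     with each other. *)
  have -> : (m.*2 - k.*2.+1 = (m - k.+1).*2.+1)%N by lia.
  have [_ -> _ _] := coef_fib_poly_mod m (m - k.+1).
  by have [_ -> _ _] := coef_fib_poly_mod m k.
have lekm : (k <= m)%N by lia.
by rewrite coef_rev // -H //; have [-> _ _ _] := coef_fib_poly_mod m k.
Qed.

(** The constant coefficient is zero, but self-reciprocity would equate it with the leading one. *)
Lemma fib_poly_mod_even_not_self_reciprocal m : ~ self_reciprocal (F m.*2).
Proof.
case: m => [[/eqP[]]|m /self_reciprocalP[F0 H]]; first exact: fib_poly_mod0.
case/negP: F0; rewrite -lead_coef_eq0 lead_coefE -(subn0 (size _).-1) H.
  by rewrite coef0_fib_poly_mod_even.
by rewrite doubleS size_fib_poly_mod.
Qed.

End FibonacciPolynomialsModP.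

(** * Lucas-type congruences for binomial coefficients *)

Section BinomialsInCharacteristicP.

Variables (R : comNzRingType) (p : nat) (pcharRp : p \in [pchar R]).

Lemma coef_XaddC1_exp (S : comNzRingType) n i :
  (('X + 1 : {poly S}) ^+ n)`_i = ('C(n, i))%:R.
Proof.
elim: n i => [|n IH] [|i]; rewrite ?expr0 ?coef1 //.
  by rewrite exprS mulrDl mul1r coefD coefXM IH !bin0 add0r.
by rewrite exprS mulrDl mul1r coefD coefXM /= !IH -natrD binS addnC.
Qed.

(** Frobenius gives (X + 1)^(p + n) = (X^p + 1)(X + 1)^n; compare coefficients. *)
Lemma bin_pchar_addl n i :
  ('C(p + n, i))%:R =
  ('C(n, i))%:R + (if (i < p)%N then 0 else ('C(n, i - p))%:R) :> R.
Proof.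
have pcharXp : p \in [pchar {poly R}] by rewrite pchar_poly.
rewrite -!coef_XaddC1_exp exprD.
rewrite -(pFrobenius_autE pcharXp) pFrobenius_autD_comm; last exact: commr1.
rewrite pFrobenius_aut1 pFrobenius_autE mulrDl mul1r coefD coefXnM addrC.
by rewrite coef_XaddC1_exp.
Qed.

Lemma bin_pchar_small a n i : (i < p)%N ->
  ('C(p * a + n, i))%:R = ('C(n, i))%:R :> R.
Proof.
move=> ltip; elim: a => [|a IH]; first by rewrite muln0.
by rewrite mulnS -addnA bin_pchar_addl IH ltip addr0.
Qed.

(** Each further multiple of p contributes one ['C(n, i)], starting from ['C(n, p + i) = 0], which
    is where the bound on [n] enters. *)
Lemma bin_pchar_digit1 a n i : (i < p)%N -> (n < p + i)%N ->
  ('C(p * a + n, p + i))%:R = a%:R * ('C(n, i))%:R :> R.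
Proof.
move=> ltip ltn; elim: a => [|a IH].
  by rewrite muln0 mul0r add0n bin_small.
rewrite mulnS -addnA bin_pchar_addl IH ltnNge leq_addr /= addKn.
by rewrite bin_pchar_small // -natr1 mulrDl mul1r.
Qed.

End BinomialsInCharacteristicP.

Lemma bin3_mul6 n : ('C(n.+3, 3) * 6 = n.+3 * (n.+2 * n.+1))%N.
Proof. by rewrite -[6%N]/(3`!) bin_ffact !ffactnS ffactn0 /= muln1. Qed.

(** * Congruences forced on m by the symmetry of coefficients *)

Section SelfReciprocalCongruences.

Variables p m : nat.
Hypothesis p_prime : prime p.
Hypothesis bin_sym : forall k, (k <= m)%N ->
  ('C(m + k, k.*2))%:R = ('C(m.*2 - k, k))%:R :> 'F_p.

Let pcharFp : p \in [pchar 'F_p]. Proof. exact: pchar_Fp. Qed.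

Let natFp_eq0 n : (n%:R == 0 :> 'F_p) = (p %| n)%N.
Proof. by rewrite (dvdn_pcharf pcharFp). Qed.

Lemma bin_sym_mod_p : (0 < m)%N -> (p %| m.-1)%N || (p %| m - 2)%N.
Proof.
case: m bin_sym => // m' sym _.
have := sym 1%N isT; rewrite bin1 => E1.
case: m' sym E1 => [|l] sym E1; first by rewrite dvdn0.
have : ('C(l.+3, 2) * 2)%:R = ((l.*2 + 3) * 2)%:R :> 'F_p.
  rewrite !natrM; congr (_ * _); move: E1; rewrite addn1 => ->.
  by congr (_%:R); lia.
have -> : ('C(l.+3, 2) * 2 = l.+3 * l.+2)%N.
  by rewrite -[X in (_ * X)%N]/(2`!) bin_ffact !ffactnS ffactn0 /= muln1.
move=> E2; rewrite -Euclid_dvdM // -natFp_eq0.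
have -> : (l.+2.-1 * (l.+2 - 2) = l.+1 * l)%N by lia.
(* With m = l + 2 this is (m + 1)m = (m - 1)(m - 2) + 2(2m - 1). *)
have : (l.+3 * l.+2)%:R = (l.+1 * l)%:R + ((l.*2 + 3) * 2)%:R :> 'F_p.
  by rewrite -natrD; congr _%:R; lia.
by rewrite E2 => /eqP; rewrite -subr_eq0 opprD addrCA subrr addr0 oppr_eq0.
Qed.

Variable q : nat.
Hypotheses (p_gt5 : (5 < p)%N) (pE : p = q.*2.+1).

Let twoq : (q%:R : 'F_p) * 2 = - 1.
Proof.
apply/eqP; rewrite -addr_eq0 -natrM natr1 natFp_eq0 muln2.
by rewrite [X in (X %| _)%N]pE.
Qed.

(** The final contradictions are of this shape: a constant with no prime factor above 5 would vanish
    mod p. *)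
Let natFp_neq0 i j k : (2 ^ i * 3 ^ j * 5 ^ k)%:R <> 0 :> 'F_p.
Proof.
move/eqP; rewrite natFp_eq0 !Euclid_dvdM // !Euclid_dvdX //.
by case/orP => [/orP[]|] /andP[/dvdn_leq]; lia.
Qed.

(** Since 48 = 3! * 2^3, each of the three factors of the falling factorial is doubled, and 2q = -1
    then eliminates q. *)
Let bin3q n : (('C(q + n.+3, 3))%:R : 'F_p) * 48 =
  (n%:R * 2 + 5) * (n%:R * 2 + 3) * (n%:R * 2 + 1).
Proof.
have := congr1 (fun i => i%:R : 'F_p) (bin3_mul6 (q + n)).
rewrite -!addnS !natrM !natrD => E.
have -> : (48 : 'F_p) = 6 * 8 by rewrite -natrM.
rewrite mulrA E.
have -> : (q%:R + n.+3%:R) * ((q%:R + n.+2%:R) * (q%:R + n.+1%:R)) * 8 =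
  (q%:R * 2 + (n%:R * 2 + 6)) * (q%:R * 2 + (n%:R * 2 + 4))
    * (q%:R * 2 + (n%:R * 2 + 2)) :> 'F_p.
  by rewrite -[n.+3]addn3 -[n.+2]addn2 -[n.+1]addn1 !natrD; ring.
rewrite twoq; ring.
Qed.

Lemma bin_sym_neq_1_add_mulp a : (0 < a)%N -> m <> (p * a + 1)%N.
Proof.
move=> a0 mE.
have lepa : (p <= p * a)%N by rewrite leq_pmulr.
have paE : (p * a = p + p * a.-1)%N by rewrite -mulnS prednK.
have /bin_sym : (q.+1 <= m)%N by lia.
have -> : (m + q.+1 = p * a + q.+2)%N by lia.
have -> : (q.+1.*2 = p + 1)%N by lia.
(* One p is borrowed from 2pa, leaving the multiplier 2a - 1 and a remainder to which
   [bin_pchar_small] reduces the binomial. *)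
have -> : (m.*2 - q.+1 = p * (a + a.-1) + q.+2)%N by rewrite mulnDr; lia.
rewrite (bin_pchar_digit1 pcharFp) ?(bin_pchar_small pcharFp); try lia.
rewrite bin1 binSn => E1.
have /bin_sym : (q.+2 <= m)%N by lia.
have -> : (m + q.+2 = p * a + (q + 3))%N by lia.
have -> : (q.+2.*2 = p + 3)%N by lia.
have -> : (m.*2 - q.+2 = p * (a + a.-1) + q.+1)%N by rewrite mulnDr; lia.
rewrite (bin_pchar_digit1 pcharFp) ?(bin_pchar_small pcharFp); try lia.
rewrite [in RHS]bin_small // => E2.
have aE : a%:R * 3 = 3 :> 'F_p.
  have : a%:R * (q.+2%:R * 2) = q.+2%:R * 2 :> 'F_p by rewrite mulrA E1.
  have -> : q.+2%:R * 2 = 3 :> 'F_p.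
    by rewrite -[q.+2]addn2 natrD mulrDl twoq; ring.
  by [].
have : a%:R * (('C(q + 3, 3))%:R * 48) = 0 :> 'F_p by rewrite mulrA E2 mul0r.
rewrite (bin3q 0) => E3.
apply: (@natFp_neq0 0 1 1); rewrite -[RHS]E3.
have -> : a%:R * ((0%:R * 2 + 5) * (0%:R * 2 + 3) * (0%:R * 2 + 1)) =
  a%:R * 3 * 5 :> 'F_p by ring.
by rewrite aE -natrM.
Qed.

Lemma bin_sym_neq_2_add_mulp a : (0 < a)%N -> m <> (p * a + 2)%N.
Proof.
move=> a0 mE.
have lepa : (p <= p * a)%N by rewrite leq_pmulr.
have paE : (p * a = p + p * a.-1)%N by rewrite -mulnS prednK.
have /bin_sym : (q.+1 <= m)%N by lia.
have -> : (m + q.+1 = p * a + q.+3)%N by lia.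
have -> : (q.+1.*2 = p + 1)%N by lia.
have -> : (m.*2 - q.+1 = p * (a + a.-1) + (q + 4))%N by rewrite mulnDr; lia.
rewrite (bin_pchar_digit1 pcharFp) ?(bin_pchar_small pcharFp); try lia.
(* The same ['C(q + 4, 3)] occurs for k = q + 2, so the single value [C105] serves both
   equations. *)
have -> : 'C(q + 4, q.+1) = 'C(q + 4, 3).
  by rewrite -[RHS]bin_sub; [congr 'C(_, _); lia | lia].
rewrite bin1 => E1.
have /bin_sym : (q.+2 <= m)%N by lia.
have -> : (m + q.+2 = p * a + (q + 4))%N by lia.
have -> : (q.+2.*2 = p + 3)%N by lia.
have -> : (m.*2 - q.+2 = p * (a + a.-1) + q.+3)%N by rewrite mulnDr; lia.
rewrite (bin_pchar_digit1 pcharFp) ?(bin_pchar_small pcharFp); try lia.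
rewrite binSn => E2.
have q3 : q.+3%:R * 2 = 5 :> 'F_p.
  by rewrite -[q.+3]addn3 natrD mulrDl twoq; ring.
have C105 : ('C(q + 4, 3))%:R * 48 = 105 :> 'F_p by rewrite (bin3q 1); ring.
have E3 : a%:R * 120 = 105 :> 'F_p.
  have -> : a%:R * 120 = a%:R * 5 * 24 :> 'F_p by ring.
  by rewrite -q3 mulrA E1 -C105; ring.
have E4 : a%:R * 105 = 120 :> 'F_p.
  rewrite -C105 mulrA E2.
  have -> : q.+3%:R * 48 = q.+3%:R * 2 * 24 :> 'F_p by ring.
  by rewrite q3; ring.
apply: (@natFp_neq0 0 3 3).
(* Eliminating a from 120a = 105 and 105a = 120 gives 120^2 = 105^2, whose difference is 15^3. *)
have -> : (2 ^ 0 * 3 ^ 3 * 5 ^ 3 = 120 * 120 - 105 * 105)%N by [].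
by rewrite natrB // !natrM -{1}E4 mulrAC E3 subrr.
Qed.

End SelfReciprocalCongruences.

Local Close Scope ring_scope.

(* The hypothesis n <> 1 is needed: the constant f_1 = 1 is self-reciprocal. *)
Theorem theorem2p5 (p : nat) (p_prime : prime p) (p_gt5 : 5 < p)
    (n : nat) (n_neq1 : n <> 1) :
  self_reciprocal (fib_poly_mod p n) <-> n = 3 \/ n = 5.
Proof.
split; last first.
  (* For m = 1 and m = 2 the required binomials already agree as natural numbers. *)
  case=> ->; [apply/(self_reciprocal_fib_poly_mod_odd p 1)
             |apply/(self_reciprocal_fib_poly_mod_odd p 2)].
    by case=> [|[]].
  by case=> [|[|[]]].
rewrite -(odd_double_half n); set m := n./2.
case: (odd n) (odd_double_half n) => nE /=; rewrite ?add1n ?add0n; last first.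
  by move/fib_poly_mod_even_not_self_reciprocal.
move/self_reciprocal_fib_poly_mod_odd => sym.
have pE : p = p./2.*2.+1.
  have := odd_double_half p; case: (even_prime p_prime) => [|->] /=; lia.
have m0 : 0 < m by rewrite /= in nE; lia.
case/orP: (bin_sym_mod_p p_prime sym m0) => /dvdnP[a mE].
- case: (posnP a) => [a0|a0]; first by left; rewrite a0 in mE; lia.
  by case: (bin_sym_neq_1_add_mulp p_prime sym p_gt5 pE a0); lia.
(* Subtraction is truncated: [m - 2 = 0] allows m = 1 as well as m = 2, that is n = 3 or n = 5. *)
- case: (posnP a) => [a0|a0]; first by rewrite a0 in mE; lia.
  by case: (bin_sym_neq_2_add_mulp p_prime sym p_gt5 pE a0); lia.
Qed.
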